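(* There exists $\epsilon>0$ such that for every positive integer $n$, every cycle-intersecting family $\mathcal{A}$ of labelled graphs on the vertex set $[n]$ satisfies $\mu(\mathcal{A})\le\frac12-\epsilon$.
   Context: For a positive integer $n$, a family $\mathcal{A}$ of labelled graphs on the vertex set $[n]=\{1,\dots,n\}$ (identified with their edge sets, i.e. with subsets of the set of $\binom n2$ pairs) has measure $\mu(\mathcal{A})=|\mathcal{A}|/2^{\binom n2}$. The family is cycle-intersecting if for all $A,B\in\mathcal{A}$ (including the case $A=B$) the graph $A\cap B$ (intersection of edge sets) contains a cycle (of some length at least $3$). *)

(* Defs.v *)
From mathcomp Require Import all_boot all_order all_algebra.
From mathcomp Require Import reals.

Set Implicit Arguments.
Unset Strict Implicit.
Unset Printing Implicit Defensive.

Import Order.TTheory GRing.Theory Num.Theory.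

Local Open Scope ring_scope.

(* The vertex set [n] = {1, ..., n} is rendered as 'I_n = {0, ..., n-1}. *)
Definition edge (n : nat) := {e : {set 'I_n} | #|e| == 2%N}.

Definition graph (n : nat) := {set edge n}.

Definition adj (n : nat) (G : graph n) : rel 'I_n :=
  fun x y => [exists e : edge n, (e \in G) && (val e == [set x; y])].

(* [ucycle] holds of closed walks without repeated vertices, including those
   with at most two vertices; the bound on the size excludes the latter. *)
Definition has_cycle (n : nat) (G : graph n) : Prop :=
  exists2 c : seq 'I_n, (3 <= size c)%N & ucycle (adj G) c.

(* A and B are not required to be distinct. *)
Definition cycle_intersecting (n : nat) (F : {set graph n}) : Prop :=
  forall A B : graph n, A \in F -> B \in F -> has_cycle (A :&: B).

Definition mu (R : realType) (n : nat) (F : {set graph n}) : R :=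
  #|F|%:R / 2 ^+ 'C(n, 2).

Lemma card_edge (n : nat) : #|{: edge n}| = 'C(n, 2).
Proof.
rewrite card_sig -[n in RHS]card_ord -card_draws.
by apply: eq_card => e; rewrite !inE.
Qed.

Lemma card_graph (n : nat) : #|{: graph n}| = (2 ^ 'C(n, 2))%N.
Proof.
rewrite -card_edge -(cardsT (edge n)) -card_powerset.
by apply: eq_card => G; rewrite !inE subsetT.
Qed.

(* Main.v *)
Require Import Defs.
From mathcomp Require Import all_boot all_order all_algebra.
From mathcomp Require Import reals.
From mathcomp Require Import ring lra.

(* Replace the family by its up-closure F, with indicator f and measure m.
   Expose a graph Y edge by edge; at each step, averaging f over fair coin flips
   for the unexposed edges gives two means, with and without the current edge,
   that differ by some w >= 0. Include this edge with probability (1 + d w)/2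
   instead of 1/2. Since the drift d w^2/2 is proportional to the quadratic
   variation of these means, P(Y in F) exceeds m by at least a constant times
   d m (1 - m).

   Delete from Y a random set D, each exposed edge of Y lying in D with
   probability q_e = d w/(1 + d w), independently given Y. Then Y \ D, hence
   its complement B, is exactly uniform. As Y :&: B = D, the graphs Y and B
   cannot both be in F unless D has a cycle. Given Y, the expected number of
   cycles in D is at most the sum over k >= 3 of the traces of the k-th powers
   of the matrix (q_xy), which its Frobenius norm bounds by O(sum q_e^2). This
   is O(d^2) times the quadratic variation, which for small d is beaten by the
   gain, so m + c m (1 - m) <= 1 - m for a constant c > 0. *)

Set Implicit Arguments.
Unset Strict Implicit.
Unset Printing Implicit Defensive.

Import Order.TTheory GRing.Theory Num.Theory.

Local Open Scope ring_scope.

(** * One step of the biased exposure *)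

Lemma drift_step (R : realFieldType) (K d a m0 m1 p S X0 X1 : R) :
    0 <= d -> d <= 1 -> 0 <= a -> 0 <= K ->
    a / 4 + K * d ^+ 2 <= d * (1 - a) / 2 ->
    0 <= m0 -> m1 <= 1 -> m0 <= m1 -> 0 <= p ->
    p * (1 + d * (m1 - m0)) = d * (m1 - m0) ->
    m0 + a * m0 * (1 - m0) - K * S <= X0 ->
    m1 + a * m1 * (1 - m1) - K * (S + p ^+ 2) <= p * X0 + (1 - p) * X1 ->
  let m := (m1 + m0) / 2 in m + a * m * (1 - m) - K * S <= (X1 + X0) / 2.
Proof.
move=> d0 d1 a0 K0 gain m0_ge0 m1_le1 m01 p0 pE J0 J1 /=.
have [w w0 m1E] : exists2 w, 0 <= w & m1 = m0 + w.
  by exists (m1 - m0); rewrite ?subr_ge0 // addrC subrK.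
rewrite {}m1E in m1_le1 m01 pE J1 *; rewrite addrAC subrr add0r in pE.
have dw0 : 0 <= d * w by rewrite mulr_ge0.
have dw1 : d * w <= 1 by rewrite mulr_ile1 //; lra.
have dw_ge0 : 0 <= 1 + d * w by lra.
have p_le : p <= d * w.
  have pdw : 0 <= p * (d * w) by rewrite mulr_ge0.
  lra.
(* The two hypotheses are weighted by 1 + d w and 1 - d w, twice the probabilities that the current
   element is present or absent. Since (1 + d w)(1 - p) = 1, the right-hand sides add up to the fair
   sum [X0 + X1]. *)
have {}J1 := ler_wpM2l dw_ge0 J1.
have {}J0 : (1 - d * w) * (m0 + a * m0 * (1 - m0) - K * S) <=
  (1 - d * w) * X0 by rewrite ler_wpM2l // subr_ge0.
have E1 : (1 + d * w) * (p * X0 + (1 - p) * X1) = d * w * X0 + X1.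
  transitivity (p * (1 + d * w) * X0 + (1 + d * w - p * (1 + d * w)) * X1).
    by ring.
  by rewrite pE; ring.
rewrite {}E1 in J1.
have p2 : (1 + d * w) * p ^+ 2 <= 2 * (d ^+ 2 * w ^+ 2).
  rewrite ler_pM ?exprn_ge0 //; first by lra.
  by rewrite -exprMn lerXn2r // nnegrE.
have {p2} Kp : K * ((1 + d * w) * p ^+ 2) <= K * (2 * (d ^+ 2 * w ^+ 2)).
  exact: ler_wpM2l.
have G : w ^+ 2 * (a / 4 + K * d ^+ 2) <= w ^+ 2 * (d * (1 - a) / 2).
  by rewrite ler_wpM2l // exprn_ge0.
(* The drift also shifts the mean of the concave term, by a d w^2 (1 - m0 - m1)/2 >= - a d w^2/2;
   hence the factor [1 - a] in [gain]. *)
have mm : 0 <= d * w ^+ 2 * a * (2 - m0 - (m0 + w)).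
  by rewrite !mulr_ge0 ?exprn_ge0 //; lra.
lra.
Qed.

(** * Random subsets with independent elements *)

Section RandomSubset.
Variables (R : realFieldType) (E : finType).
Implicit Types (q : E -> R) (h : {set E} -> R) (D Y : {set E}) (s : seq E).

Definition expect q h : R :=
  \sum_(D : {set E}) (\prod_e (if e \in D then q e else 1 - q e)) * h D.

Lemma eq_expect q q' h h' : q =1 q' -> h =1 h' -> expect q h = expect q' h'.
Proof.
move=> qq hh; apply: eq_bigr => D _; rewrite hh; congr (_ * _).
by apply: eq_bigr => e _; rewrite qq.
Qed.

Lemma expectD q h h' :
  expect q (fun D => h D + h' D) = expect q h + expect q h'.
Proof. by rewrite -big_split; apply: eq_bigr => D _; rewrite mulrDr. Qed.

Lemma expectZ q a h : expect q (fun D => a * h D) = a * expect q h.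
Proof. by rewrite /expect mulr_sumr; apply: eq_bigr => D _; rewrite mulrCA. Qed.

Lemma expect_sum q (I : Type) (r : seq I) (P : pred I) (F : I -> {set E} -> R) :
  expect q (fun D => \sum_(i <- r | P i) F i D) =
  \sum_(i <- r | P i) expect q (F i).
Proof.
by rewrite exchange_big; apply: eq_bigr => D _; rewrite mulr_sumr.
Qed.

Lemma expect_sub q (S : {set E}) :
  expect q (fun D => (S \subset D)%:R) = \prod_(e in S) q e.
Proof.
(* Expanding this product gives one term per [D], and the summand 0 kills every [D] that misses an
   element of [S]. *)
transitivity (\prod_e (q e + (if e \in S then 0 else 1 - q e))).
  rewrite bigA_distr; apply: eq_bigr => D _.
  case: (boolP (S \subset D)) => SD; rewrite ?mulr1 ?mulr0.
    apply: eq_bigr => e _; case: ifPn => // eD.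
    by rewrite (contraNF (subsetP SD e)).
  have [e eS eD] := subsetPn SD.
  by rewrite (bigD1 e) //= (negPf eD) eS mul0r.
rewrite [RHS]big_mkcond; apply: eq_bigr => e _.
by case: ifP => _; rewrite ?addr0 // addrC subrK.
Qed.

Lemma expect_const q a : expect q (fun _ => a) = a.
Proof.
rewrite (@eq_expect q q _ (fun D => a * (set0 \subset D)%:R)) //.
  by rewrite expectZ expect_sub big_set0 mulr1.
by move=> D; rewrite sub0set mulr1.
Qed.

Lemma ler_expect q h h' : (forall e, 0 <= q e <= 1) ->
  (forall D, h D <= h' D) -> expect q h <= expect q h'.
Proof.
move=> q01 hh; apply: ler_sum => D _; rewrite ler_wpM2l ?hh //.
apply: prodr_ge0 => e _; have /andP[q0 q1] := q01 e.
by case: ifP; rewrite ?subr_ge0.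
Qed.

(** Conditions on whether [e] is drawn. As [q e = 0], a draw under [q] almost surely misses [e] and
    so describes the remaining elements in both cases. *)
Lemma expect_upd q e p h : q e = 0 ->
  expect [eta q with e |-> p] h =
  p * expect q (fun D => h (e |: D)) + (1 - p) * expect q h.
Proof.
move=> qe0.
pose wt r D : R := \prod_(x | x != e) (if x \in D then r x else 1 - r x).
have wtE r D : \prod_x (if x \in D then r x else 1 - r x) =
    (if e \in D then r e else 1 - r e) * wt r D by rewrite (bigD1 e).
have q_sum g : expect q g = \sum_(D : {set E} | e \notin D) wt q D * g D.
  rewrite /expect (bigID (fun D : {set E} => e \in D)) /= big1 ?add0r.
    by apply: eq_bigr => D /negPf eD; rewrite wtE eD qe0 subr0 mul1r.
  by move=> D eD; rewrite wtE eD qe0 !mul0r.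
have wt_upd D : wt [eta q with e |-> p] D = wt q D.
  by apply: eq_bigr => x /negPf xe /=; rewrite xe.
have wt_add D : wt q (e |: D) = wt q D.
  by apply: eq_bigr => x /negPf xe; rewrite !inE xe.
rewrite !q_sum /expect (bigID (fun D : {set E} => e \in D)) /=; congr (_ + _).
  rewrite (reindex_onto (fun D => e |: D) (fun D => D :\ e)) /=; last first.
    by move=> D eD; rewrite setD1K.
  rewrite mulr_sumr; apply: eq_big => [D|D].
    rewrite setU11 /=; apply/eqP/idP => [<-|eD]; first by rewrite !inE eqxx.
    by rewrite setU1K.
  by rewrite wtE setU11 /= eqxx wt_upd wt_add mulrA.
rewrite mulr_sumr; apply: eq_bigr => D /negPf eD.
by rewrite wtE eD /= eqxx wt_upd mulrA.
Qed.

Lemma eq_expect_notin q e h h' : q e = 0 ->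
  (forall D, e \notin D -> h D = h' D) -> expect q h = expect q h'.
Proof.
move=> qe0 hh; apply: eq_bigr => D _.
have [eD|/hh -> //] := boolP (e \in D).
by rewrite (bigD1 e) //= eD qe0 !mul0r.
Qed.

Definition avg s h Y : R :=
  expect (fun e => if e \in s then 1 / 2 else 0) (fun D => h (Y :|: D)).

Lemma avg_nil h Y : avg [::] h Y = h Y.
Proof.
rewrite /avg /expect (bigD1 set0) //= [X in _ + X]big1 ?addr0.
  by rewrite setU0 big1 ?mul1r // => e _; rewrite inE subr0.
move=> D /set0Pn[e eD].
by rewrite (bigD1 e) //= eD !mul0r.
Qed.

Lemma avg_cons e s h Y : e \notin s ->
  avg (e :: s) h Y = (avg s h (e |: Y) + avg s h Y) / 2.
Proof.
move=> es; pose q x : R := if x \in s then 1 / 2 else 0.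
have qe : q e = 0 by rewrite /q (negPf es).
rewrite /avg (@eq_expect _ [eta q with e |-> 1 / 2] _
                (fun D => h (Y :|: D))) //.
  rewrite expect_upd //.
  rewrite (@eq_expect q q (fun D => h (Y :|: (e |: D)))
             (fun D => h (e |: Y :|: D))) // => [|D]; last first.
    by rewrite setUCA setUA.
  rewrite -/(avg s h (e |: Y)) -/(avg s h Y); lra.
by move=> x /=; rewrite inE /q; case: eqP.
Qed.

Lemma avg_enum h : avg (enum E) h set0 = (\sum_D h D) / 2 ^+ #|E|.
Proof.
rewrite /avg /expect mulr_suml; apply: eq_bigr => D _; rewrite set0U mulrC.
congr (_ * _); rewrite -exprVn -prodr_const; apply: eq_bigr => e _.
by rewrite mem_enum inE; case: ifP => _; lra.
Qed.

Lemma avg_const s a Y : avg s (fun=> a) Y = a.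
Proof. exact: expect_const. Qed.

Lemma ler_avg s h Y h' Y' :
  (forall D, h (Y :|: D) <= h' (Y' :|: D)) -> avg s h Y <= avg s h' Y'.
Proof.
move=> hh; apply: ler_expect => // e.
by case: ifP => _; apply/andP; split; lra.
Qed.

(** * Gain of the biased exposure over the fair one *)

Section Growth.
Variables (K : R) (f h : {set E} -> R).
Hypothesis (f01 : forall Y, f Y = 0 \/ f Y = 1).
Hypothesis (f_mono : forall Y Y', Y \subset Y' -> f Y <= f Y').
Hypothesis (fh : forall q Y, (forall e, 0 <= q e <= 1) ->
  f Y - K * (\sum_e q e ^+ 2) <= expect q (fun D => h (Y :\: D))).
Variables (d a : R).
Hypotheses (d_ge0 : 0 <= d) (d_le1 : d <= 1) (a_ge0 : 0 <= a) (K_ge0 : 0 <= K).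
Hypothesis (gain : a / 4 + K * d ^+ 2 <= d * (1 - a) / 2).

(* [Y] is the set exposed so far, [q] gives the probabilities with which its
   elements go to [D], and [s] lists the elements still to be exposed. The term
   [a * m * (1 - m)] vanishes once [f] is determined; when the two values of the
   next conditional mean differ by [w] it loses [a * w ^+ 2 / 4], which pays for
   a fraction of the gain [d * w ^+ 2 / 2] due to the drift. *)
Lemma drift s Y q : uniq s -> (forall e, e \in s -> e \notin Y) ->
  (forall e, e \in s -> q e = 0) -> (forall e, 0 <= q e <= 1) ->
  let m := avg s f Y in
  m + a * m * (1 - m) - K * (\sum_e q e ^+ 2) <=
    expect q (fun D => avg s h (Y :\: D)).
Proof.
elim: s Y q => [|e s IH] Y q /=.
  move=> _ _ _ q01; rewrite avg_nil.
  have -> : f Y + a * f Y * (1 - f Y) = f Y by case: (f01 Y) => ->; ring.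
  apply: le_trans (fh Y q01) _; apply: ler_expect => // D.
  by rewrite avg_nil.
case/andP=> es us sY sq q01.
have eY : e \notin Y by apply: sY; rewrite mem_head.
have qe : q e = 0 by apply: sq; rewrite mem_head.
rewrite avg_cons //; set m1 := avg s f (e |: Y); set m0 := avg s f Y.
have m0_ge0 : 0 <= m0.
  rewrite -(avg_const s 0 Y); apply: ler_avg => D.
  by case: (f01 (Y :|: D)) => ->.
have m1_le1 : m1 <= 1.
  rewrite -[leRHS](avg_const s 1 Y); apply: ler_avg => D.
  by case: (f01 (e |: Y :|: D)) => ->.
have m01 : m0 <= m1.
  by apply: ler_avg => D; rewrite f_mono // -setUA subsetUr.
pose w := m1 - m0; pose p := d * w / (1 + d * w).
have dw0 : 0 <= d * w by rewrite mulr_ge0 ?subr_ge0.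
have dw_gt0 : 0 < 1 + d * w by lra.
have pE : p * (1 + d * w) = d * w by rewrite /p divfK // gt_eqF.
have p0 : 0 <= p by rewrite divr_ge0 // ltW.
have p1 : p <= 1 by rewrite ler_pdivrMr // mul1r lerDr.
have IH1 : let q' := [eta q with e |-> p] in
    m1 + a * m1 * (1 - m1) - K * (\sum_e q' e ^+ 2) <=
    expect q' (fun D => avg s h ((e |: Y) :\: D)).
  apply: IH => // [x xs|x xs|x] /=.
  - rewrite !inE negb_or sY ?inE ?xs ?orbT // andbT.
    by apply: contraNneq es => <-.
  - case: eqP => [xe|_]; first by rewrite xe (negPf es) in xs.
    by rewrite sq ?inE ?xs ?orbT.
  - by case: eqP => // _; rewrite p0.
have IH0 : m0 + a * m0 * (1 - m0) - K * (\sum_e q e ^+ 2) <=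
    expect q (fun D => avg s h (Y :\: D)).
  by apply: IH => // x xs; rewrite (sY, sq) ?inE ?xs ?orbT.
have sumE : \sum_x [eta q with e |-> p] x ^+ 2 = \sum_x q x ^+ 2 + p ^+ 2.
  rewrite (bigD1 e) //= eqxx [in RHS](bigD1 e) //= qe expr0n add0r addrC.
  by congr (_ + _); apply: eq_bigr => x /negPf /= ->.
rewrite /= sumE expect_upd // in IH1.
(* [X1] and [X0] stand for [e] ending up inside and outside of [Y :\: D]. The latter happens in two
   ways: [e] is exposed as absent, or as present and then deleted. *)
set X1 := expect q (fun D => avg s h (e |: (Y :\: D))).
set X0 := expect q (fun D => avg s h (Y :\: D)) in IH0 *.
have e1 : expect q (fun D => avg s h ((e |: Y) :\: D)) = X1.
  apply: (eq_expect_notin qe) => D eD; congr avg; apply/setP => x.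
  by rewrite !inE; case: eqP => // ->; rewrite eD.
have e0 : expect q (fun D => avg s h ((e |: Y) :\: (e |: D))) = X0.
  apply: eq_expect => // D; congr avg; apply/setP => x.
  by rewrite !inE; case: eqP => //= ->; rewrite (negPf eY) andbF.
rewrite e1 e0 in IH1.
have -> : expect q (fun D => avg (e :: s) h (Y :\: D)) = (X1 + X0) / 2.
  rewrite (@eq_expect _ q _ (fun D => 2^-1 * (avg s h (e |: (Y :\: D)) +
    avg s h (Y :\: D)))) // => [|D]; last by rewrite avg_cons // mulrC.
  by rewrite expectZ expectD mulrC.
apply: (drift_step d_ge0 d_le1 a_ge0 K_ge0 gain m0_ge0 m1_le1 m01 p0 pE).
  exact: IH0.
exact: IH1.
Qed.

End Growth.
End RandomSubset.

(** * Closed walks, traces and the Frobenius norm *)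

Section ClosedWalks.
Variables (R : realFieldType) (T : finType).

Lemma cauchy_schwarz_sum (I : finType) (a b : I -> R) :
  (\sum_i a i * b i) ^+ 2 <= (\sum_i a i ^+ 2) * (\sum_i b i ^+ 2).
Proof.
set A := \sum_i a i ^+ 2; set B := \sum_i b i ^+ 2; set C := \sum_i _.
have B0 : 0 <= B by apply: sumr_ge0 => i _; rewrite sqr_ge0.
have : 0 <= B * (A * B - C ^+ 2).
  have -> : B * (A * B - C ^+ 2) = \sum_i (B * a i - C * b i) ^+ 2.
    transitivity (\sum_i (B ^+ 2 * a i ^+ 2 +
      (- (2 * B * C) * (a i * b i) + C ^+ 2 * b i ^+ 2))).
      by rewrite !big_split -!mulr_sumr -/A -/B -/C /=; ring.
    by apply: eq_bigr => i _; ring.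
  by apply: sumr_ge0 => i _; rewrite sqr_ge0.
move: B0; rewrite le_eqVlt => /predU1P[B0 _|B0]; last first.
  by rewrite pmulr_rge0 // subr_ge0.
have b0 i : b i = 0.
  apply/eqP; rewrite -sqrf_eq0; apply: contraTT isT => bi.
  suff : 0 < B by rewrite -B0 ltxx.
  rewrite /B (bigD1 i) //= ltr_wpDr ?lt_def ?bi ?sqr_ge0 //.
  by apply: sumr_ge0 => j _; rewrite sqr_ge0.
by rewrite -B0 mulr0 /C big1 ?expr0n // => i _; rewrite b0 mulr0.
Qed.

Variable P : T -> T -> R.

(* [k] is the number of interior vertices: the walks have [k.+1] steps. *)
Fixpoint walk_weight k x y : R :=
  if k is k'.+1 then \sum_z P x z * walk_weight k' z y else P x y.

Lemma sum_walks k x y :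
  \sum_(s : k.-tuple T) \prod_(a <- pairmap P x (rcons s y)) a =
  walk_weight k x y.
Proof.
elim: k x => [|k IH] x /=.
  rewrite (bigD1 [tuple]) //= [X in _ + X]big1 ?addr0.
    by rewrite big_seq1.
  by move=> s /eqP[]; apply: tuple0.
under [RHS]eq_bigr do rewrite -IH mulr_sumr.
rewrite pair_big /= (reindex (fun p : T * k.-tuple T => [tuple of p.1 :: p.2])).
  by apply: eq_bigr => -[z s] _ /=; rewrite big_cons.
exists (fun s : k.+1.-tuple T => (thead s, [tuple of behead s])).
  by move=> [z s] _ /=; congr pair; apply: val_inj.
by move=> s _ /=; rewrite -tuple_eta.
Qed.

Definition frob2 : R := \sum_x \sum_y P x y ^+ 2.

(** Submultiplicativity of the Frobenius norm: [walk_weight k] is the matrix power P^(k+1). *)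
Lemma sum_sqr_walk k :
  \sum_x \sum_y walk_weight k x y ^+ 2 <= frob2 ^+ k.+1.
Proof.
elim: k => [|k IH]; first by rewrite expr1.
apply: (@le_trans _ _ (\sum_x \sum_y ((\sum_z P x z ^+ 2) *
    (\sum_z walk_weight k z y ^+ 2)))).
  by apply: ler_sum => x _; apply: ler_sum => y _; apply: cauchy_schwarz_sum.
under eq_bigr do rewrite -mulr_sumr exchange_big /=.
rewrite -mulr_suml exprS ler_wpM2l //.
by apply: sumr_ge0 => x _; apply: sumr_ge0 => y _; rewrite sqr_ge0.
Qed.

(** The trace of P^(k+2) is the inner product of P with the transpose of P^(k+1), so Cauchy-Schwarz
    applies. *)
Lemma sqr_trace_walk k :
  (\sum_x walk_weight k.+1 x x) ^+ 2 <= frob2 ^+ k.+2.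
Proof.
rewrite /= pair_big /=.
apply: le_trans (cauchy_schwarz_sum (fun p : T * T => P p.1 p.2)
  (fun p : T * T => walk_weight k p.2 p.1)) _.
rewrite -(pair_big xpredT xpredT (fun x z => P x z ^+ 2)) /=.
rewrite -(pair_big xpredT xpredT (fun x z => walk_weight k z x ^+ 2)) /=.
rewrite exchange_big [X in _ * X]exchange_big /= [leLHS]mulrC exprS mulrC.
rewrite [X in X * _]exchange_big /= ler_wpM2l ?sum_sqr_walk //.
by apply: sumr_ge0 => x _; apply: sumr_ge0 => y _; rewrite sqr_ge0.
Qed.

(** With F for [frob2], the trace of P^(k+3) is at most F^((k+3)/2) <= F / 2^(k+1), and these bounds
    form a geometric series. *)
Lemma sum_trace_walk n : frob2 <= 1 / 4 ->
  \sum_(k < n) \sum_x walk_weight k.+2 x x <= frob2.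
Proof.
have F0 : 0 <= frob2.
  by apply: sumr_ge0 => x _; apply: sumr_ge0 => y _; rewrite sqr_ge0.
move=> F4; apply: (@le_trans _ _ (\sum_(k < n) frob2 * (1 / 2) ^+ k.+1)).
  apply: ler_sum => k _; apply: le_trans (ler_norm _) _.
  rewrite -ler_sqr ?nnegrE ?mulr_ge0 ?exprn_ge0 ?normr_ge0 //; last by lra.
  rewrite real_normK ?num_real //; apply: le_trans (sqr_trace_walk _) _.
  rewrite exprMn -exprM mulnC exprM -[k.+3]add2n exprD ler_wpM2l ?exprn_ge0 //.
  by rewrite lerXn2r ?nnegrE //; lra.
rewrite -mulr_sumr -[leRHS]mulr1 ler_wpM2l //.
suff -> : \sum_(k < n) (1 / 2) ^+ k.+1 = 1 - (1 / 2) ^+ n :> R.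
  by rewrite lerBlDr lerDl exprn_ge0 //; lra.
elim: n => [|n IH]; first by rewrite big_ord0 expr0 subrr.
by rewrite big_ord_recr /= IH !exprS; lra.
Qed.

End ClosedWalks.

(** * Cycles in a random graph *)

Lemma has_cycleS n (A B : graph n) : A \subset B -> has_cycle A -> has_cycle B.
Proof.
move=> AB [c c3 /andP[cA uc]]; exists c => //; rewrite /ucycle uc andbT.
apply: sub_cycle cA => x y /existsP[e /andP[eA exy]].
by apply/existsP; exists e; rewrite (subsetP AB).
Qed.

Section RandomGraph.
Variables (R : realFieldType) (n : nat) (q : edge n -> R).
Hypothesis (q01 : forall e, 0 <= q e <= 1).

(** The default 0 makes the matrix [edge_prob] vanish on the diagonal. *)
Definition edge_weight (a : {set 'I_n}) : R := oapp q 0 (insub a).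
Definition edge_prob (x y : 'I_n) : R := edge_weight [set x; y].

Lemma edge_weight_ge0 a : 0 <= edge_weight a.
Proof. by rewrite /edge_weight; case: insub => //= e; case/andP: (q01 e). Qed.

Lemma prod_edge_prob_ge0 x s : 0 <= \prod_(a <- pairmap edge_prob x s) a.
Proof.
elim: s x => [|y s IH] x /=; first by rewrite big_nil.
by rewrite big_cons mulr_ge0 ?edge_weight_ge0.
Qed.

(** Distinct edges are drawn independently; if some entry of [L] is not a pair, the left side is
    0. *)
Lemma expect_edges (L : seq {set 'I_n}) : uniq L ->
  expect q (fun D => (all [in [set val e | e in D]] L)%:R) <=
  \prod_(a <- L) edge_weight a.
Proof.
move=> uL.
have [/allP vL|/allPn[a aL a2]] :=
  boolP (all (fun a : {set 'I_n} => #|a| == 2%N) L).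
  pose l : seq (edge n) := pmap insub L.
  have lL : map val l = L.
    rewrite /l (pmap_filter (insubK _)); apply/all_filterP/allP => a aL.
    by rewrite isSome_insub; apply: vL.
  rewrite -[in leRHS]lL big_map.
  have -> : \prod_(e <- l) edge_weight (val e) = \prod_(e in [set e in l]) q e.
    rewrite big_uniq ?pmap_sub_uniq //=; apply: eq_big => e; rewrite ?inE //.
    by rewrite /edge_weight valK.
  rewrite -expect_sub; apply: ler_expect => // D; rewrite ler_nat.
  case: allP => //= lD; suff -> : [set e in l] \subset D by [].
  apply/subsetP => e; rewrite inE => el.
  have := lD (val e); rewrite -lL map_f // mem_imset //; last exact: val_inj.
  exact.
apply: (@le_trans _ _ 0); last first.
  by apply: prodr_ge0 => b _; apply: edge_weight_ge0.
rewrite -(expect_const q 0); apply: ler_expect => // D.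
case: allP => // /(_ a aL) /imsetP[e _ ae].
by case/negP: a2; rewrite ae; exact: (valP e).
Qed.

Definition sides (x : 'I_n) s := pairmap (fun u v => [set u; v]) x s.

Lemma sides_notin x y s a :
  x != y -> x \notin s -> a \in sides y s -> x \notin a.
Proof.
elim: s y => //= z s IH y xy; rewrite !inE negb_or => /andP[xz xs].
by case/orP => [/eqP ->|]; [rewrite !inE negb_or xy | apply: IH].
Qed.

Lemma uniq_sides x s : uniq (x :: s) -> uniq (sides x s).
Proof.
elim: s x => //= y s IH x /andP[]; rewrite inE negb_or => /andP[xy xs] ys.
rewrite IH // andbT; apply/negP => /(sides_notin xy xs).
by rewrite !inE eqxx.
Qed.

(** Of the other sides only the first contains [x], and its other end is the head of [s], which
    differs from the last entry once [s] has two entries. *)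
Lemma uniq_closed_sides x s : (2 <= size s)%N -> uniq (x :: s) ->
  uniq (sides x (rcons s x)).
Proof.
move=> s2 us; rewrite /sides -cats1 pairmap_cat /= cats1 rcons_uniq.
rewrite uniq_sides // andbT.
case: s s2 us => //= y s s_gt0 /and3P[]; rewrite inE negb_or.
move=> /andP[xy xs] ys us; rewrite inE negb_or; apply/andP; split; last first.
  by apply/negP => /(sides_notin xy xs); rewrite !inE eqxx orbT.
apply/eqP => /setP/(_ y); rewrite !inE eqxx orbT [y == x]eq_sym (negPf xy) orbF.
move=> /eqP ly; case: s s_gt0 xs ys us ly => // z s _ _ + _ ly.
by rewrite ly /= mem_last.
Qed.

Lemma path_sides (D : graph n) x s : path (adj D) x s ->
  all [in [set val e | e in D]] (sides x s).
Proof.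
elim: s x => //= y s IH x /andP[/existsP[e /andP[eD /eqP exy]] /IH ->].
by rewrite andbT -exy imset_f.
Qed.

Lemma expect_cycle x s : (2 <= size s)%N -> uniq (x :: s) ->
  expect q (fun D => (cycle (adj D) (x :: s))%:R) <=
  \prod_(a <- pairmap edge_prob x (rcons s x)) a.
Proof.
move=> s2 us; have -> : pairmap edge_prob x (rcons s x) =
    map edge_weight (sides x (rcons s x)).
  by elim: (rcons s x) {1 3}x => //= y t IH z; rewrite IH.
rewrite big_map; apply: le_trans (expect_edges (uniq_closed_sides s2 us)).
apply: ler_expect => // D; rewrite ler_nat /=.
by case: (boolP (path _ _ _)) => // /path_sides ->.
Qed.

(** An edge fills two matrix entries; counting all four pairs of its ends, diagonal included, gives
    the constant 4. *)
Lemma frob2_edge_prob : frob2 edge_prob <= 4 * \sum_e q e ^+ 2.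
Proof.
rewrite /frob2 pair_big /=.
have -> : 4 * \sum_e q e ^+ 2 =
    \sum_e \sum_(p in setX (val e) (val e)) q e ^+ 2.
  rewrite mulr_sumr; apply: eq_bigr => e _.
  by rewrite sumr_const cardsX (eqP (valP e)) mulr_natl.
under [leRHS]eq_bigr do rewrite big_mkcond.
rewrite exchange_big /=; apply: ler_sum => -[x y] _ /=.
have ge0 e : 0 <= (if (x, y) \in setX (val e) (val e) then q e ^+ 2 else 0).
  by case: ifP; rewrite ?sqr_ge0.
rewrite /edge_prob /edge_weight; case: insubP => [e _ exy|_] /=.
  rewrite (bigD1 e) //= exy !inE !eqxx orbT /= lerDl.
  by apply: sumr_ge0 => e' _; apply: ge0.
by rewrite expr0n /=; apply: sumr_ge0 => e _; apply: ge0.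
Qed.

(* [k] counts the vertices of the cycle other than its starting point [x]. *)
Lemma has_cycle_count (D : graph n) : has_cycle D ->
  1 <= \sum_(k < n) \sum_x \sum_(s : k.+2.-tuple 'I_n | uniq (x :: s))
    (cycle (adj D) (x :: s))%:R :> R.
Proof.
case=> -[//|x s] /= s2 /andP[cs us].
have sn : ((size s).-2 < n)%N.
  have := max_card [in x :: s]; rewrite card_ord (card_uniqP us) /=.
  by apply: leq_trans; rewrite ltnS -subn2 leq_subr.
have s_eq : size s == ((size s).-2).+2 by case: (s) s2 => [|? []].
rewrite (bigD1 (Ordinal sn)) //= (bigD1 x) //= (bigD1 (Tuple s_eq)) //=.
rewrite /= in cs; rewrite cs -!addrA lerDl !addr_ge0 //.
- by apply: sumr_ge0.
- by apply: sumr_ge0 => ? _; apply: sumr_ge0.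
- by apply: sumr_ge0 => ? _; apply: sumr_ge0 => ? _; apply: sumr_ge0.
Qed.

Lemma cycle_bound (f : graph n -> R) (Y : graph n) :
  (forall A, f A = 0 \/ f A = 1) ->
  (forall A B, f A = 1 -> f B = 1 -> has_cycle (A :&: B)) ->
  f Y - 16 * (\sum_e q e ^+ 2) <=
    expect q (fun D => 1 - f (~: (Y :\: D))).
Proof.
move=> f01 fC; set S := \sum_e _; set X := expect _ _.
have X0 : 0 <= X.
  rewrite -(expect_const q 0); apply: ler_expect => // D.
  by case: (f01 (~: (Y :\: D))) => ->; lra.
have S0 : 0 <= S by apply: sumr_ge0 => e _; rewrite sqr_ge0.
have fY1 : f Y <= 1 by case: (f01 Y) => ->; lra.
(* If [frob2] exceeds 1/4, then 16 S > 1 >= f Y and the claim is trivial, which is where 16 comes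
   from. Otherwise the traces are summable and 4 S already suffices. *)
have [P4|P4] := lerP (frob2 edge_prob) (1 / 4); last first.
  by have := frob2_edge_prob; rewrite -/S; lra.
pose cyc D : R := \sum_(k < n) \sum_x
  \sum_(s : k.+2.-tuple 'I_n | uniq (x :: s)) (cycle (adj D) (x :: s))%:R.
have cyc0 D : 0 <= cyc D.
  by apply: sumr_ge0 => k _; apply: sumr_ge0 => x _; apply: sumr_ge0.
have : f Y <= X + expect q cyc.
  rewrite -(expect_const q (f Y)) -expectD; apply: ler_expect => // D.
  have := cyc0 D.
  case: (f01 Y) => fY; rewrite fY.
    by case: (f01 (~: (Y :\: D))) => ->; lra.
  case: (f01 (~: (Y :\: D))) => fD; rewrite fD; first by lra.
  suff : 1 <= cyc D by lra.
  apply: has_cycle_count; apply: has_cycleS (fC _ _ fY fD).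
  by rewrite setCD setIUr setICr set0U subsetIr.
have : expect q cyc <= frob2 edge_prob.
  apply: le_trans (sum_trace_walk n P4).
  rewrite expect_sum; apply: ler_sum => k _; rewrite expect_sum.
  apply: ler_sum => x _; rewrite expect_sum -sum_walks.
  (* The trace counts all closed walks; those with repeated vertices are dropped, their weights
     being nonnegative. *)
  rewrite [leRHS](bigID (fun s : _.-tuple _ => uniq (x :: s))) /=.
  rewrite ler_wpDr //.
    by apply: sumr_ge0 => s _; apply: prod_edge_prob_ge0.
  by apply: ler_sum => s us; apply: expect_cycle; rewrite ?size_tuple.
by have := frob2_edge_prob; rewrite -/S; lra.
Qed.

End RandomGraph.

Theorem theorem3p2 (R : realType) :
  exists2 eps : R, 0 < eps &
    forall (n : nat) (n_gt0 : (0 < n)%N) (F : {set graph n}),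
      cycle_intersecting F -> mu R F <= 1 / 2 - eps.
Proof.
exists (1 / 4096) => [|n _ F FC]; first by lra.
have d_ge0 : 0 <= 1 / 64 :> R by lra.
have d_le1 : 1 / 64 <= 1 :> R by lra.
have a_ge0 : 0 <= 1 / 128 :> R by lra.
have K_ge0 : 0 <= 16 :> R by lra.
have gain : 1 / 128 / 4 + 16 * (1 / 64) ^+ 2 <=
  1 / 64 * (1 - 1 / 128) / 2 :> R by lra.
pose f (A : graph n) : R := [exists B in F, B \subset A]%:R.
have f01 A : f A = 0 \/ f A = 1 by rewrite /f; case: [exists _ in _, _]; auto.
have f1P A : f A = 1 -> exists2 B, B \in F & B \subset A.
  rewrite /f; case: exists_inP => [//|_ /esym/eqP].
  by rewrite oner_eq0.
have f_mono (A B : graph n) : A \subset B -> f A <= f B.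
  rewrite /f ler_nat => AB; case: exists_inP => // -[C CF CA].
  by rewrite (_ : [exists _ in _, _]) //; apply/exists_inP; exists C;
     rewrite ?(subset_trans CA).
have fC A B : f A = 1 -> f B = 1 -> has_cycle (A :&: B).
  move=> /f1P[A' A'F sA] /f1P[B' B'F sB].
  exact: has_cycleS (setISS sA sB) (FC _ _ A'F B'F).
pose m : R := avg (enum {: edge n}) f set0.
have cardE : 2 ^+ #|{: edge n}| = \sum_(A : graph n) 1 :> R.
  by rewrite sumr_const card_graph card_edge natrX.
have mu_m : mu R F <= m.
  rewrite /m avg_enum /mu card_edge ler_wpM2r ?invr_ge0 ?exprn_ge0 //.
  rewrite -sum1_card natr_sum big_mkcond; apply: ler_sum => A _ /=.
  case: ifP => AF; last by case: (f01 A) => ->.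
  by rewrite /f ler_nat lt0b; apply/exists_inP; exists A.
have mh : avg (enum {: edge n}) (fun B => 1 - f (~: B)) set0 = 1 - m.
  rewrite /m !avg_enum sumrB -cardE mulrBl mulfV ?expf_neq0 ?pnatr_eq0 //.
  congr (1 - _ / _); rewrite [RHS](reindex_inj (@setC_inj _)) /=.
  by apply: eq_bigr.
have main : m + 1 / 128 * m * (1 - m) <= 1 - m.
  have q01 (e : edge n) : 0 <= (0 : R) <= 1 by rewrite lexx ler01.
  have notin0 (e : edge n) : e \in enum {: edge n} -> e \notin set0.
    by rewrite inE.
  (* The exposure starts with [Y] empty and [q = 0], so [D] is empty too and the right-hand side is
     the fair average given by [mh]. *)
  have := drift (h := fun B => 1 - f (~: B)) f01 f_mono
    (fun q Y q01 => cycle_bound q01 Y f01 fC) d_ge0 d_le1 a_ge0 K_ge0 gain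
    (enum_uniq _) notin0 (fun _ _ => erefl) q01.
  rewrite -/m /= [\sum_e _]big1 => [|e _]; last by rewrite expr0n.
  rewrite mulr0 subr0 => /le_trans; apply.
  rewrite (@eq_expect _ _ _ (fun=> 0) _ (fun=> 1 - m)) // => [|D]; last first.
    by rewrite set0D.
  by rewrite expect_const.
have m_ge0 : 0 <= m.
  by apply: le_trans mu_m; rewrite divr_ge0 ?exprn_ge0.
have m_le1 : m <= 1.
  rewrite -[leRHS](avg_const (enum {: edge n}) 1 set0); apply: ler_avg => D.
  by case: (f01 (set0 :|: D)) => ->.
apply: le_trans mu_m _; move: m m_ge0 m_le1 main {mh} => m m_ge0 m_le1 main.
clear -m_ge0 m_le1 main; rewrite leNgt; apply/negP => m_gt.
have m_le : m <= 1 / 2.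
  have : 0 <= m * (1 - m) by rewrite mulr_ge0 // subr_ge0.
  lra.
(* Here m >= 1/4 and 1 - m >= 1/2, so [main] yields 2 m <= 1 - 1/1024, contradicting m > 1/2 -
   1/4096. *)
have : 1 / 4 * (1 / 2) <= m * (1 - m) by apply: ler_pM => //; lra.
lra.
Qed.
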